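(* Let $\mathbb{F}$ be a field, let $n\ge1$, let $f,g\in\mathbb{F}[x_1,\ldots,x_n]\setminus\mathbb{F}$ and let $h\in\mathbb{F}[x_1,\ldots,x_n]$ be nonzero, with $f=gh$. Suppose that $h$ is multilinear, and that $s,d\in\mathbb{N}$ satisfy $\|f\|_0\le s$ and $\operatorname{indeg}(f)\le d$. Write $D=\operatorname{tdeg}(f)$. Then \[ \|h\|_0\le s,\qquad \|g\|_0\le s^{(2d+2)D+2}. \]
   Context: For a polynomial $P$ over $\mathbb{F}$, $\|P\|_0$ denotes the number of monomials occurring in $P$ with nonzero coefficient. For nonzero $P$, $\operatorname{tdeg}(P)$ is its total degree, and $\operatorname{indeg}(P)$ is its individual degree (the maximum exponent of any single variable in any monomial of $P$). A polynomial is multilinear if every variable occurs in each of its monomials with exponent at most $1$. *)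

(* Defs.v *)
From HB Require Import structures.
From mathcomp Require Import all_boot all_order all_algebra.
From mathcomp Require Export mpoly.

Set Implicit Arguments.
Unset Strict Implicit.
Unset Printing Implicit Defensive.

Import GRing.Theory.
Local Open Scope ring_scope.

Definition mconstant (F : fieldType) (n : nat) (p : {mpoly F[n]}) : Prop :=
  exists c : F, p = c%:MP.

Definition sparsity (F : fieldType) (n : nat) (p : {mpoly F[n]}) : nat :=
  size (msupp p).

(* [msize p] is one more than the total degree when [p != 0]; both [tdeg] and
   [indeg] take the junk value 0 at [p = 0]. *)
Definition tdeg (F : fieldType) (n : nat) (p : {mpoly F[n]}) : nat :=
  (msize p).-1.

Definition indeg (F : fieldType) (n : nat) (p : {mpoly F[n]}) : nat :=
  (\max_(m <- msupp p) \max_(i < n) m i)%N.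

Definition multilinear_mpoly (F : fieldType) (n : nat) (p : {mpoly F[n]}) :
    Prop :=
  forall m : 'X_{1..n}, m \in msupp p -> forall i : 'I_n, (m i <= 1)%N.

(* Main.v *)
(** For a monomial [m] of the multilinear [h], let the weight of an exponent
    vector be the sum of its entries, those in the support of [m] counted
    negatively: [m] is the only monomial of [h] of minimal weight.  If [a] is a
    monomial of [g], then either [a + m] is a monomial of [g * h], or it is
    cancelled by some [a' + m'] with [m' <> m], and then [a'] is a monomial of
    [g] lighter than [a].

    If [a] has minimal weight in [g], then [a + m] occurs in [g * h] and
    determines [m]; hence [h] has at most as many monomials as [f].  In general,
    weights on [g] lie between [- tdeg f] and [tdeg f], so iterating
    the alternative at most [K = 2 * tdeg f] times writes [a + (K + 1) m] as a
    monomial of [f] plus [K] monomials of [h]; thus [g] has at most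
    [s ^ (2 * tdeg f + 1)] monomials.  This is the expansion of [f / h] as a
    geometric series around the term [m] of [h]. *)
Require Import Defs.
From HB Require Import structures.
From mathcomp Require Import all_boot all_order all_algebra.
From mathcomp Require Import mpoly.
From mathcomp Require Import zify.

Set Implicit Arguments.
Unset Strict Implicit.
Unset Printing Implicit Defensive.

Import GRing.Theory.
Local Open Scope ring_scope.

(** The coefficient of [a + m] in [g * h] contains the nonzero product [g@_a * h@_m]; if it
    vanishes, another product in the sum is nonzero. Its [m'] differs from [m], as otherwise
    [a' = a]. *)
Lemma msupp_mul_or_collision (F : idomainType) n (g h : {mpoly F[n]}) a m :
  a \in msupp g -> m \in msupp h ->
  (a + m)%MM \in msupp (g * h) \/
  exists a' m', [/\ a' \in msupp g, m' \in msupp h, m' != m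
                  & (a' + m' = a + m)%MM].
Proof.
move=> ga hm; have [|nfam] := boolP ((a + m)%MM \in msupp (g * h)); first by left.
right.
have lta : (mdeg a < (mdeg (a + m)).+1)%N by rewrite mdegD ltnS leq_addr.
have ltm : (mdeg m < (mdeg (a + m)).+1)%N by rewrite mdegD ltnS leq_addl.
have := memN_msupp_eq0 nfam.
rewrite mcoeffM (bigD1 (BMultinom lta, BMultinom ltm)) //= => sum0.
case: (boolP [exists k : 'X_{1..n < (mdeg (a + m)).+1, (mdeg (a + m)).+1},
   [&& (a + m == k.1 + k.2)%MM, k != (BMultinom lta, BMultinom ltm),
   (k.1 : 'X_{1..n}) \in msupp g & (k.2 : 'X_{1..n}) \in msupp h]]).
  case/existsP=> -[[a' lta'] [m' ltm']] /= /and4P[/eqP eam ne ga' hm'].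
  exists a', m'; split=> //; apply: contra ne => /eqP em.
  have ea : a' = a by move: eam; rewrite em => /addIm.
  by apply/eqP; congr pair; apply: val_inj.
move=> /existsPn none; move: sum0; rewrite big1 => [|k /andP[ek nek]].
  move/eqP; rewrite addr0 mulf_eq0 -[_ == 0]negbK -[h@__ == 0]negbK.
  by rewrite -!mcoeff_msupp ga hm.
apply/eqP; rewrite mulf_eq0; have := none k; rewrite ek nek /= negb_and.
by case/orP => /memN_msupp_eq0 ->; rewrite eqxx ?orbT.
Qed.

Definition flip_weight n (m x : 'X_{1..n}) : int :=
  \sum_(i < n) (if m i == 0%N then (x i)%:Z else - (x i)%:Z).

Lemma flip_weightD n (m x y : 'X_{1..n}) :
  flip_weight m (x + y)%MM = flip_weight m x + flip_weight m y.
Proof.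
rewrite /flip_weight -big_split; apply: eq_bigr => i _ /=; rewrite mnmDE.
by case: ifP => _; lia.
Qed.

Lemma flip_weight_bound n (m x : 'X_{1..n}) :
  (- (mdeg x)%:Z <= flip_weight m x <= (mdeg x)%:Z)%R.
Proof.
rewrite mdegE /flip_weight.
elim/big_rec2: _ => [|i y z _ IH]; first by lia.
by case: ifP => _; lia.
Qed.

(** For 0/1 vectors the difference of the two weights is the number of coordinates where [x] and [m]
    differ. *)
Lemma flip_weight_min n (m x : 'X_{1..n}) :
  (forall i, (m i <= 1)%N) -> (forall i, (x i <= 1)%N) -> x != m ->
  (flip_weight m m < flip_weight m x)%R.
Proof.
move=> m1 x1 nexm.
have [i nei] : exists i, x i != m i.
  apply/existsP; rewrite -negb_forall; apply: contra nexm => /forallP e.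
  by apply/eqP/mnmP => i; apply/eqP.
rewrite /flip_weight (bigD1 i) //= [X in (_ < X)%R](bigD1 i) //=.
apply: Num.Theory.ltr_leD.
  by move: (m1 i) (x1 i) nei; case: ifP; lia.
apply: Num.Theory.ler_sum => j _.
by move: (m1 j) (x1 j); case: ifP; lia.
Qed.

Lemma exists_min_weight n (w : 'X_{1..n} -> int) (r : seq 'X_{1..n}) :
  r != [::] -> exists2 a, a \in r & forall b, b \in r -> (w a <= w b)%R.
Proof.
elim: r => [//|x [|y r] IH] _.
  by exists x; rewrite ?mem_head // => b; rewrite inE => /eqP ->.
have [a ra mina] := IH isT.
have [le|lt] := Order.TotalTheory.leP (w a) (w x).
  exists a; first by rewrite inE ra orbT.
  by move=> b; rewrite inE => /orP[/eqP ->|/mina].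
exists x; first exact: mem_head.
by move=> b; rewrite inE => /orP[/eqP ->|/mina]; lia.
Qed.

Lemma sparsity_multilinear_factor (F : fieldType) n (g h : {mpoly F[n]}) :
  g != 0 -> multilinear_mpoly h -> (sparsity h <= sparsity (g * h))%N.
Proof.
move=> g0 hml.
(* Minimality is phrased with [all] to be boolean, so that [xchoose] applies. *)
have lightest m : exists a, (a \in msupp g) &&
    all (fun b => (flip_weight m a <= flip_weight m b)%R) (msupp g).
  have [|a ga mina] := @exists_min_weight _ (flip_weight m) (msupp g).
    by rewrite msupp_eq0.
  by exists a; rewrite ga; apply/allP.
pose a m := xchoose (lightest m).
have ga m : a m \in msupp g by case/andP: (xchooseP (lightest m)).
have mina m b : b \in msupp g -> (flip_weight m (a m) <= flip_weight m b)%R.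
  by case/andP: (xchooseP (lightest m)) => _ /allP; apply.
have no_collision m b m' : m \in msupp h -> b \in msupp g -> m' \in msupp h ->
    (b + m' = a m + m)%MM -> m' = m.
  move=> hm gb hm' e; apply/eqP; apply/negPn/negP => ne.
  have := congr1 (flip_weight m) e; rewrite !flip_weightD.
  have := flip_weight_min (hml _ hm) (hml _ hm') ne.
  by have := mina m b gb; lia.
rewrite /sparsity -(size_map (fun m => a m + m)%MM); apply: uniq_leq_size.
  rewrite map_inj_in_uniq ?msupp_uniq // => m m' hm hm' e.
  (* An equality [a m + m = a m' + m'] is itself a collision at [m']. *)
  by apply: (no_collision m' (a m) m).
move=> _ /mapP[m hm ->].
have [//|[b [m' [gb hm' /eqP ne e]]]] := msupp_mul_or_collision (ga m) hm.
by case: ne; apply: no_collision e.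
Qed.

(** Repetitions are kept, so the size is an exact product. *)
Fixpoint sumset_iter n (r t : seq 'X_{1..n}) (k : nat) : seq 'X_{1..n} :=
  if k is k'.+1 then [seq (x + y)%MM | x <- sumset_iter r t k', y <- t] else r.

Lemma size_sumset_iter n (r t : seq 'X_{1..n}) k :
  size (sumset_iter r t k) = (size r * size t ^ k)%N.
Proof.
by elim: k => [|k IH] /=; rewrite ?muln1 // size_allpairs IH expnSr mulnA.
Qed.

Lemma sumset_iter_pad n (r t : seq 'X_{1..n}) x y k :
  x \in r -> y \in t -> (x + y *+ k)%MM \in sumset_iter r t k.
Proof.
move=> rx ty; elim: k => [|k IH] /=; first by rewrite mulm0n addm0.
by apply/allpairsP; exists (x + y *+ k, y)%MM; rewrite mulmSr addmA.
Qed.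

(** Induction on [K]: each cancellation lowers the integer weight by at least 1, and no weight on
    [g] is below [- N]. *)
Lemma msupp_cofactor_sumset (F : fieldType) n (g h : {mpoly F[n]}) m N K a :
  multilinear_mpoly h -> m \in msupp h ->
  (forall b, b \in msupp g -> (mdeg b <= N)%N) ->
  a \in msupp g -> (flip_weight m a <= K%:Z - N%:Z)%R ->
  (a + m *+ K.+1)%MM \in sumset_iter (msupp (g * h)) (msupp h) K.
Proof.
move=> hml hm degg; elim: K a => [|K IH] a ga wa.
all: have [fam|[a' [m' [ga' hm' ne e]]]] := msupp_mul_or_collision ga hm.
all: try by rewrite mulmS addmA; apply: sumset_iter_pad.
all: have wm := flip_weight_min (hml _ hm) (hml _ hm') ne.
all: have := congr1 (flip_weight m) e; rewrite !flip_weightD => we.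
  by have := flip_weight_bound m a'; have := degg _ ga'; lia.
apply/allpairsP; exists (a' + m *+ K.+1, m')%MM; split => //=.
  by apply: IH => //; lia.
by rewrite mulmS addmA -e -!addmA [(m' + _)%MM]addmC.
Qed.

Lemma sparsity_cofactor (F : fieldType) n (g h : {mpoly F[n]}) :
  g != 0 -> h != 0 -> multilinear_mpoly h ->
  (sparsity g <= sparsity (g * h) * sparsity h ^ (2 * tdeg (g * h)))%N.
Proof.
move=> g0 h0 hml; set N := tdeg (g * h).
have degg b : b \in msupp g -> (mdeg b <= N)%N.
  move=> gb; rewrite /N /tdeg msizeM // -ltnS.
  have h_gt0 : (0 < msize h)%N by rewrite lt0n msize_poly_eq0.
  rewrite -(prednK h_gt0) addnS /=; apply: leq_trans (leqSpred _).
  exact: leq_trans (msize_mdeg_lt gb) (leq_addr _ _).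
have hm : mlead h \in msupp h by apply: mlead_supp.
rewrite /sparsity -size_sumset_iter.
rewrite -(size_map (fun a => a + mlead h *+ (2 * N).+1)%MM).
apply: uniq_leq_size.
  by rewrite map_inj_uniq ?msupp_uniq // => x y /addIm.
move=> _ /mapP[a ga ->].
apply: (msupp_cofactor_sumset hml hm degg) => //.
(* The weight of [a] is at most [N = 2 * N - N]. *)
by have := flip_weight_bound (mlead h) a; have := degg _ ga; lia.
Qed.

Theorem theorem4p2 (F : fieldType) (n : nat) (hn : (1 <= n)%N)
    (f g h : {mpoly F[n]})
    (hf : ~ mconstant f) (hg : ~ mconstant g) (hh : h != 0)
    (hfgh : f = g * h)
    (hml : multilinear_mpoly h)
    (s d : nat) (hs : (sparsity f <= s)%N) (hd : (indeg f <= d)%N) :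
  (sparsity h <= s)%N /\
  (sparsity g <= s ^ ((2 * d + 2) * tdeg f + 2))%N.
Proof.
have g0 : g != 0 by apply/eqP => g0; apply: hg; exists 0; rewrite g0 mpolyC0.
have hleq : (sparsity h <= s)%N.
  by apply: leq_trans hs; rewrite hfgh; apply: sparsity_multilinear_factor.
split=> //.
have s_gt0 : (0 < s)%N.
  by apply: leq_trans hleq; rewrite lt0n size_eq0 msupp_eq0.
apply: (@leq_trans (s ^ (2 * tdeg f).+1)%N); last by rewrite leq_pexp2l //; nia.
apply: leq_trans (sparsity_cofactor g0 hh hml) _.
(* [leq_exp2r] needs a positive exponent; exponent 0 is trivial. *)
by rewrite -hfgh expnS leq_mul //; case: (2 * _)%N => // e; rewrite leq_exp2r.
Qed.
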